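(* If $x$ is a modular element in a lattice $L$, then every chain in $L$ embeds (as a poset) into the direct product $x^\downarrow\times x^\uparrow$, and consequently \[ \mathrm{Ht}(L)=\mathrm{Ht}(x^\downarrow)+\mathrm{Ht}(x^\uparrow)-1. \]
   Context: The height $\mathrm{Ht}(P)$ of a poset $P$ is the supremum of the cardinalities of chains in $P$ (for infinite heights, sums are cardinal sums, and subtracting a finite number from an infinite cardinal leaves it unchanged). For an element $x$ of a lattice $L$, $x^\downarrow=\{a\in L:a\le x\}$ and $x^\uparrow=\{a\in L:a\geq x\}$. The element $x$ is modular if $a\vee(x\wedge b)=(a\vee x)\wedge b$ for all $a,b\in L$ with $a\leq b$. *)

(* Defs.v *)
From HB Require Import structures.
From mathcomp Require Import all_boot all_order.
From mathcomp Require Import boolp classical_sets functions cardinality.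

Set Implicit Arguments.
Unset Strict Implicit.
Unset Printing Implicit Defensive.

Local Open Scope classical_set_scope.
Local Open Scope card_scope.

(* The library has no type of cardinals, only the relations #<= and #= between
   sets (of possibly different types).  Accordingly, a cardinal is represented
   below by any set having that cardinality, and an equality between cardinals
   is an equipotence #= between representatives. *)

Definition is_card_sup (T U : Type) (F : set (set T)) (K : set U) : Prop :=
  (forall A, F A -> A #<= K) /\
  (forall (V : Type) (B : set V), (forall A, F A -> A #<= B) -> K #<= B).

(* Cardinals are well-ordered: take a maximal set M of choice functions on F
   that pairwise differ at every member of F; evaluation at some A in F is then
   a bijection from M to A, and A is the smallest member. *)
Lemma card_min_exists (T : Type) (F : set (set T)) :
  F !=set0 -> exists2 A, F A & forall B, F B -> A #<= B.
Proof.
move=> [A0 FA0].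
pose P (M : set (set T -> T)) :=
  (forall f A, M f -> F A -> A (f A)) /\
  (forall f g A, M f -> M g -> F A -> f A = g A -> f = g).
have [G GP totG|M [[MP1 MP2] Mmax]] := @Zorn_bigcup _ P.
  split=> [f A [X GX Xf]|f g A [X GX Xf] [Y GY Yg] FA fg].
    by case: (GP _ GX) => + _; apply.
  have [XY|YX] := totG _ _ GX GY.
    by case: (GP _ GY) => _ /(_ f g A (XY _ Xf) Yg FA fg).
  by case: (GP _ GX) => _ /(_ f g A Xf (YX _ Yg) FA fg).
have [[A FA AM]|noA] := pselect (exists2 A, F A &
    forall a, A a -> exists2 f, M f & f A = a).
  exists A => // B FB; apply: (@card_le_trans _ _ _ M).
    have [[a Aa]|/set0P/negP/negPn/eqP ->] := pselect (A !=set0); last exact: card_ge0.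
    have [f0 _ _] := AM a Aa.
    have [h hP] : {h : T -> (set T -> T) | forall a, A a -> M (h a) /\ h a A = a}.
      suff /choice[h hP] : forall a, exists f, A a -> M f /\ f A = a by exists h.
      move=> b; have [/AM[f Mf fA]|nAb] := pselect (A b); first by exists f.
      by exists f0.
    have : $|{injfun A >-> M}|.
      apply/injfunPex; exists h => [b /hP[]//|b c /set_mem/hP[_ hb] /set_mem/hP[_ hc] e].
      by rewrite -hb -hc e.
    by case=> i; exact: inj_card_le i.
  have : $|{injfun M >-> B}|.
    apply/injfunPex; exists (fun f => f B) => [f Mf|f g /set_mem Mf /set_mem Mg].
      exact: (MP1 _ _ Mf FB).
    exact: (MP2 _ _ _ Mf Mg FB).
  by case=> i; exact: inj_card_le i.
have {}noA A : F A -> exists a, A a /\ forall f, M f -> f A <> a.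
  move=> FA; apply: contrapT => H; apply: noA; exists A => // a Aa.
  apply: contrapT => H2; apply: H; exists a; split=> // f Mf fa.
  by apply: H2; exists f.
have [t0 _] := noA _ FA0.
have [g gP] : exists g : set T -> T,
    forall A, F A -> A (g A) /\ forall f, M f -> f A <> g A.
  suff /choice[g gP] : forall A, exists a, F A -> A a /\ forall f, M f -> f A <> a.
    by exists g.
  move=> A; have [/noA[a aP]|nFA] := pselect (F A); first by exists a.
  by exists t0.
have PMg : P (M `|` [set g]).
  split=> [f A [Mf|->] FA|f h A [Mf|->] [Mh|->] FA] //.
  - exact: (MP1 _ _ Mf FA).
  - exact: (gP _ FA).1.
  - exact: (MP2 _ _ _ Mf Mh FA).
  - by move=> e; case: ((gP _ FA).2 _ Mf).
  - by move=> e; case: ((gP _ FA).2 _ Mh).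
exfalso; apply: (Mmax (M `|` [set g])) => //.
split; first by move=> f Mf; left.
by move=> /(_ g (or_intror erefl)) Mg; exact: (gP _ FA0).2 g Mg erefl.
Qed.

Lemma card_le_total (T U : Type) (A : set T) (B : set U) : A #<= B \/ B #<= A.
Proof.
have eA : [set @inl T U a | a in A] #= A by apply: inj_card_eq => ? ? _ _ [].
have eB : [set @inr T U b | b in B] #= B by apply: inj_card_eq => ? ? _ _ [].
have [|X XP Xmin] := @card_min_exists (T + U)%type
   [set X | X = [set inl a | a in A] \/ X = [set inr b | b in B]].
  by eexists; left.
case: XP => XE; [left|right].
  by rewrite -(card_le_eql eA) -(card_le_eqr eB) -XE; apply: Xmin; right.
by rewrite -(card_le_eql eB) -(card_le_eqr eA) -XE; apply: Xmin; left.
Qed.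

Lemma card_sup_exists (T : Type) (F : set (set T)) :
  exists K : set T, is_card_sup F K.
Proof.
have [|K KF Kmin] := @card_min_exists T [set K | forall A, F A -> A #<= K].
  by exists setT => A _; exact: card_leT.
exists K; split=> // V B BF; have [//|BK] := card_le_total K B.
have /card_leP[i] := BK.
pose h (b : B) : T := val (i b).
have e : range h #= B.
  apply: (card_eq_trans _ (card_setT B)).
  by apply: inj_card_eq => b c bT cT /val_inj; exact: inj.
by rewrite -(card_le_eqr e); apply: Kmin => A /BF; rewrite (card_le_eqr e).
Qed.

Definition card_sup (T : Type) (F : set (set T)) : set T :=
  sval (cid (card_sup_exists F)).

Lemma card_supP (T : Type) (F : set (set T)) : is_card_sup F (card_sup F).
Proof. exact: (svalP (cid (card_sup_exists F))). Qed.

Definition card_add (T U : Type) (A : set T) (B : set U) : set (T + U) :=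
  [set inl a | a in A] `|` [set inr b | b in B].

(* Subtracting 1 is removing an arbitrary element: this leaves an infinite
   cardinal unchanged (and sends 0 to 0). *)
Definition card_sub1 (T : Type) (A : set T) : set T :=
  if pselect (A !=set0) is left A0 then A `\ sval (cid A0) else A.

Section Height.
Context {d : Order.disp_t} {P : porderType d}.

Definition chain (C : set P) : Prop := total_on C (fun a b => (a <= b)%O).

(* The height of the subposet D of P. *)
Definition height (D : set P) : set P :=
  card_sup [set C | C `<=` D /\ chain C].

Definition down_set (x : P) : set P := [set a | (a <= x)%O].
Definition up_set (x : P) : set P := [set a | (x <= a)%O].

End Height.

Definition modular_elt {d : Order.disp_t} {L : latticeType d} (x : L) : Prop :=
  forall a b : L, (a <= b)%O ->
    (a `|` (x `&` b) = (a `|` x) `&` b)%O.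

(* Main.v *)
Require Import Defs.
From HB Require Import structures.
From mathcomp Require Import all_boot all_order.
From mathcomp Require Import boolp classical_sets functions cardinality.

Local Open Scope classical_set_scope.
Local Open Scope card_scope.

Set Implicit Arguments.
Unset Strict Implicit.
Unset Printing Implicit Defensive.

Import Order.TTheory.

(** If [x] is modular and [a <= b] have the same meet
    and the same join with [x], then [a = b] ([modular_cancel]).  The monotone
    map sending [a] to the pair of its meet and its join with [x] is therefore
    injective on every chain, and a monotone injection of a chain is an
    embedding ([meet_join_mono]).

    Upper bound for the height.  By the embedding, it suffices to bound a chain
    [C] of pairs by the sum of its two projections, minus 1.  Code an element of
    [C] by its first coordinate if it is the least one with that first
    coordinate, and by its second coordinate otherwise.  This code is injective,
    and if [C] has a least element then the second coordinate of that element is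
    never used as a code; this is the missing 1 ([card_chain_prod_sub1]).  If
    [C] is infinite, subtracting 1 changes nothing.  The code is an injection
    into a disjoint sum, so that products of infinite cardinals do not occur.

    Lower bound.  A chain below [x] and a chain above [x], together with [x],
    form a chain, whose cardinality is at least their sum minus 1
    ([card_sub1_add_le_setU]).  If the height of the lattice is finite, the two
    suprema are attained ([finite_card_sup]) and this is enough.  If it is an
    infinite cardinal [k], both heights are at most [k], and [k + k = k]
    ([infinite_card_add]).  This half holds in every poset. *)

(** * Sums and differences of cardinals *)

Lemma set_inj_card_le (T U : Type) (A : set T) (B : set U) (f : T -> U) :
  set_fun A B f -> set_inj A f -> A #<= B.
Proof.
move=> fAB finj; have [i] : $|{injfun A >-> B}| by apply/injfunPex; exists f.
exact: inj_card_le i.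
Qed.

Lemma card_le_set_inj (T U : Type) (A : set T) (B : set U) :
  A #<= B -> B !=set0 -> exists2 f : T -> U, set_fun A B f & set_inj A f.
Proof.
move=> /card_leP[i] [b Bb].
pose f t := if pselect (A t) is left At then val (i (SigSub (mem_set At))) else b.
exists f => [t At|s t /set_mem As /set_mem At]; rewrite /f.
  by case: pselect => // h; exact: set_valP.
case: pselect => // hs; case: pselect => // ht /val_inj e.
have /(congr1 val) // : SigSub (mem_set hs) = SigSub (mem_set ht).
by apply: (@inj _ _ _ i) => //; rewrite inE.
Qed.

(** If an injection of [A] into [B] sends some [t] other than [a] to [b],
    redirect [t] to the value at [a], which is free once [a] is removed. *)
Lemma card_le_setD1 (T U : Type) (A : set T) (B : set U) (a : T) (b : U) :
  A a -> B b -> A #<= B -> A `\ a #<= B `\ b.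
Proof.
move=> Aa Bb /card_le_set_inj[|f fAB finj]; first by exists b.
have f_inj s t : A s -> A t -> f s = f t -> s = t.
  by move=> As At; apply: finj; apply: mem_set.
pose g t := if pselect (f t = b) then f a else f t.
apply: (@set_inj_card_le _ _ _ _ g) => [t [At ta]|s t]; rewrite /g.
  case: pselect => [ftb|ftb] /=; split => //; try exact: fAB.
  by move=> /= fab; apply: ta; apply: f_inj => //; rewrite fab ftb.
move=> /set_mem[As sa] /set_mem[At ta].
case: pselect => fs; case: pselect => ft /= e.
- by apply: f_inj => //; rewrite fs ft.
- by case: ta; apply: f_inj.
- by case: sa; apply: f_inj.
- exact: f_inj.
Qed.

Lemma card_add0l (T U : Type) (B : set U) : card_add (@set0 T) B #= B.
Proof.
by rewrite /card_add image_set0 set0U; apply: inj_card_eq => ? ? _ _ [].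
Qed.

Lemma card_add0r (T U : Type) (A : set T) : card_add A (@set0 U) #= A.
Proof.
by rewrite /card_add image_set0 setU0; apply: inj_card_eq => ? ? _ _ [].
Qed.

Lemma card_le_add (T T' U U' : Type) (A : set T) (A' : set T')
    (B : set U) (B' : set U') :
  A #<= A' -> B #<= B' -> card_add A B #<= card_add A' B'.
Proof.
have [[a0 A0]|/set0P/negP/negPn/eqP ->] := pselect (A' !=set0); last first.
  move=> /card_le0P -> BB'.
  by rewrite (card_le_eql (card_add0l _ _)) (card_le_eqr (card_add0l _ _)).
have [[b0 B0]|/set0P/negP/negPn/eqP ->] := pselect (B' !=set0); last first.
  move=> AA' /card_le0P ->.
  by rewrite (card_le_eql (card_add0r _ _)) (card_le_eqr (card_add0r _ _)).
move=> /card_le_set_inj[|f fAA finj]; first by exists a0.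
move=> /card_le_set_inj[|g gBB ginj]; first by exists b0.
pose h (s : T + U) : T' + U' :=
  match s with inl a => inl (f a) | inr b => inr (g b) end.
apply: (@set_inj_card_le _ _ _ _ h) => [_ [[a Aa <-]|[b Bb <-]]|s t].
- by left; exists (f a) => //; exact: fAA.
- by right; exists (g b) => //; exact: gBB.
- move=> /set_mem[[a Aa <-]|[b Bb <-]] /set_mem[[a' Aa' <-]|[b' Bb' <-]] //= [e].
    by congr inl; apply: finj => //; exact: mem_set.
  by congr inr; apply: ginj => //; exact: mem_set.
Qed.

Lemma card_le_setU_add (T : Type) (A B : set T) : A `|` B #<= card_add A B.
Proof.
pose h t : T + T := if pselect (A t) then inl t else inr t.
apply: (@set_inj_card_le _ _ _ _ h) => [t [At|Bt]|s t _ _]; rewrite /h.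
- by case: pselect => //= ?; left; exists t.
- by case: pselect => /= h'; [left|right]; exists t.
- by case: pselect => ?; case: pselect => ? //= [].
Qed.

(** Split [A], by Zorn's lemma, into disjoint sequences and a remainder too
    small to contain another one, that is, a finite one.  Within each sequence
    [s] the doubling is done by [(s n, b) |-> s (2 n + b)], and the remainder
    is absorbed by doubling once more. *)
Lemma infinite_card_add (T : Type) (A : set T) :
  infinite_set A -> card_add A A #<= A.
Proof.
move=> Ainf.
pose P (M : set (nat -> T)) :=
  (forall s n, M s -> A (s n)) /\
  (forall s s' n n', M s -> M s' -> s n = s' n' -> s = s' /\ n = n').
have [G GP totG|M [[MA MI] Mmax]] := @Zorn_bigcup _ P.
  split=> [s n [X GX Xs]|s s' n n' [X GX Xs] [Y GY Ys']].
    by case: (GP _ GX) => + _; apply.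
  have [XY|YX] := totG _ _ GX GY.
    by case: (GP _ GY) => _; apply => //; exact: XY.
  by case: (GP _ GX) => _; apply => //; exact: YX.
pose X := [set t | exists s n, M s /\ s n = t].
have Rfin : finite_set (A `\` X).
  apply: contrapT => Rinf; have [r Rr] := infinite_setN0 Rinf.
  have /card_le_set_inj[|s sR sinj] := (infiniteP (A `\` X)).1 Rinf.
    by exists r.
  have s_inj n n' : s n = s n' -> n = n' by apply: sinj; rewrite inE.
  have sX s' n n' : M s' -> s n <> s' n'.
    by move=> Ms' e; have [_] := sR n I; apply; exists s', n'.
  (* A sequence of distinct points of the remainder could be added to [M]. *)
  apply: (Mmax (M `|` [set s])); last split=> [s' n [Ms'|->]|s1 s2 n n'].
  - split; first by move=> ?; left.
    by move=> /(_ s (or_intror erefl)) /(sX s 0 0); apply.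
  - exact: MA.
  - by have [] := sR n I.
  - move=> [M1|->] [M2|->]; first exact: MI.
    + by move=> /esym /sX; case/(_ M1).
    + by move=> /sX; case/(_ M2).
    + by move=> /s_inj.
have [[s0 M0]|noM] := pselect (M !=set0); last first.
  exfalso; apply: Ainf; apply: sub_finite_set Rfin => a Aa; split=> // -[s [n [Ms _]]].
  by apply: noM; exists s.
(* [c t] locates [t]: its sequence and its index in that sequence. *)
have [c cP] : exists c : T -> (nat -> T) * nat,
    forall t, X t -> M (c t).1 /\ (c t).1 (c t).2 = t.
  suff /choice[c cP] : forall t, exists c : (nat -> T) * nat,
      X t -> M c.1 /\ c.1 c.2 = t by exists c.
  move=> t; have [[s [n Xt]]|nX] := pselect (X t); first by exists (s, n).
  by exists (s0, 0).
have XX : card_add X X #<= X.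
  pose h (u : T + T) := match u with
    | inl t => (c t).1 (c t).2.*2
    | inr t => (c t).1 (c t).2.*2.+1 end.
  have XM t : X t -> M (c t).1 by move=> /cP[].
  apply: (@set_inj_card_le _ _ _ _ h) => [_ [[t Xt <-]|[t Xt <-]]|u v].
  - by exists (c t).1, (c t).2.*2; split=> //; exact: XM.
  - by exists (c t).1, (c t).2.*2.+1; split=> //; exact: XM.
  have cinj t t' : X t -> X t' -> (c t).1 = (c t').1 -> (c t).2 = (c t').2 -> t = t'.
    by move=> /cP[_ e] /cP[_ e'] e1 e2; rewrite -e -e' e1 e2.
  move=> /set_mem[[t Xt <-]|[t Xt <-]] /set_mem[[t' Xt' <-]|[t' Xt' <-]] /=;
    move=> /MI -/(_ (XM _ Xt) (XM _ Xt'))[e1 e2].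
  - by congr inl; apply: cinj => //; exact: double_inj.
  - by move: (congr1 odd e2); rewrite /= !odd_double.
  - by move: (congr1 odd e2); rewrite /= !odd_double.
  - by congr inr; apply: cinj => //; apply: double_inj; case: e2.
have natX : [set: nat] #<= X.
  apply: (@set_inj_card_le _ _ _ _ s0) => [n _|n n' _ _ /MI]; first by exists s0, n.
  by case/(_ M0 M0).
have AX : A #<= X.
  apply: card_le_trans XX.
  apply: (@card_le_trans _ _ _ ((A `\` X) `|` X)).
    by apply: subset_card_le => t At; have [|] := pselect (X t); [right|left].
  apply: card_le_trans (card_le_setU_add _ _) _.
  apply: card_le_add => //.
  exact: card_le_trans (finite_set_countable Rfin) natX.
apply: card_le_trans (card_le_add AX AX) _.
apply: card_le_trans XX _; apply: subset_card_le => t [s [n [Ms <-]]].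
exact: MA.
Qed.

Lemma card_sub1_le (T : Type) (A : set T) : card_sub1 A #<= A.
Proof.
by rewrite /card_sub1; case: pselect => // A0; apply: subset_card_le => t [].
Qed.

(** The element that [card_sub1] removes is unspecified; by this lemma any
    element of [B] may be taken in its place. *)
Lemma card_le_sub1P (T U : Type) (A : set T) (B : set U) (b : U) :
  B b -> A #<= B `\ b -> A #<= card_sub1 B.
Proof.
move=> Bb /card_le_trans; apply; rewrite /card_sub1.
case: pselect => [B0|[]]; last by exists b.
by apply: card_le_setD1 => //; case: (cid B0).
Qed.

Lemma card_le_sub1 (T U : Type) (A : set T) (B : set U) :
  A #<= B -> card_sub1 A #<= card_sub1 B.
Proof.
move=> AB; rewrite {1}/card_sub1; case: pselect => [A0|nA]; last first.
  have -> : A = set0 by apply: contrapT => /eqP/set0P.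
  exact: card_ge0.
case: (cid A0) => a Aa /=.
have [b Bb] : B !=set0.
  apply: contrapT => nB; have B0 : B = set0 by apply: contrapT => /eqP/set0P.
  by move: AB; rewrite B0 => /card_le0P A00; rewrite A00 in Aa.
by apply: (@card_le_sub1P _ _ _ _ b) => //; exact: card_le_setD1.
Qed.

(** The removed point is absorbed by the infinite rest [B], because
    [B + 1 <= B + B <= B]. *)
Lemma infinite_card_sub1 (T : Type) (A : set T) :
  infinite_set A -> A #<= card_sub1 A.
Proof.
move=> Ainf; have [a Aa] := infinite_setN0 Ainf.
apply: (@card_le_sub1P _ _ _ _ a) => //.
have Binf : infinite_set (A `\ a) by apply: infinite_setD => //; exact: finite_set1.
apply: card_le_trans (infinite_card_add Binf).
apply: (@card_le_trans _ _ _ ((A `\ a) `|` [set a])).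
  by apply: subset_card_le => t At; have [|] := pselect (t = a); [right|left].
apply: card_le_trans (card_le_setU_add _ _) _; apply: card_le_add => //.
have [b Bb] := infinite_setN0 Binf.
by apply: (@set_inj_card_le _ _ _ _ (fun=> b)) => // s t /set_mem -> /set_mem ->.
Qed.

(** Pigeonhole principle. *)
Lemma finite_card_le_sub1 (T : Type) (A : set T) :
  finite_set A -> A #<= card_sub1 A -> A = set0.
Proof.
move=> [[|n]] An AA; first by apply/eqP; rewrite -(@card_eq0 _ nat) -II0.
have /eq_cardSP[a Aa An'] := An.
have : A #<= A `\ a.
  apply: card_le_trans AA _; rewrite /card_sub1; case: pselect => [A0|[]].
    by apply: card_le_setD1 => //; case: (cid A0).
  by exists a.
by rewrite (card_le_eql An) (card_le_eqr An') card_le_II ltnn.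
Qed.

(** No injection of [A] into [B] is onto, so that each misses a point of [B]. *)
Lemma card_le_sub1_proper (T U : Type) (A : set T) (B : set U) :
  A #<= B -> ~ (B #<= A) -> A #<= card_sub1 B.
Proof.
move=> AB nBA; have B0 : B !=set0.
  by apply: contrapT => nB; apply: nBA; rewrite (_ : B = set0) ?card_ge0//;
     apply: contrapT => /eqP/set0P.
have [f fAB finj] := card_le_set_inj AB B0.
have [b [Bb nfb]] : exists b, B b /\ ~ (f @` A) b.
  apply: contrapT => H; apply: nBA; apply: card_le_trans (card_image_le f A).
  by apply: subset_card_le => b Bb; apply: contrapT => nfb; apply: H; exists b.
apply: (@card_le_sub1P _ _ _ _ b) => //.
by apply: (@set_inj_card_le _ _ _ _ f) => // t At; split;
  [exact: fAB|move=> /= e; apply: nfb; exists t].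
Qed.

(** If every member is smaller than the supremum, then the supremum minus 1 is
    still an upper bound, which is absurd for a finite cardinal other than 0. *)
Lemma finite_card_sup (T : Type) (F : set (set T)) :
  F !=set0 -> finite_set (card_sup F) -> exists2 A, F A & card_sup F #<= A.
Proof.
move=> [A0 FA0] Kfin; have [KF Kmin] := card_supP F.
apply: contrapT => H.
have K0 : card_sup F = set0.
  apply: finite_card_le_sub1 => //; apply: Kmin => A FA.
  apply: card_le_sub1_proper; first exact: KF.
  by move=> KA; apply: H; exists A.
by apply: H; exists A0 => //; rewrite K0 card_ge0.
Qed.

(** * Heights of posets *)

Section Heights.
Context {d : Order.disp_t} {P : porderType d}.

Lemma chain_le_height (C D : set P) : C `<=` D -> chain C -> C #<= height D.
Proof. by move=> CD Cch; apply: (card_supP _).1. Qed.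

Lemma height_le (D : set P) (U : Type) (B : set U) :
  (forall C, C `<=` D -> chain C -> C #<= B) -> height D #<= B.
Proof. by move=> H; apply: (card_supP _).2 => C [CD Cch]; exact: H. Qed.

Lemma finite_height (D : set P) : finite_set (height D) ->
  exists C : set P, [/\ C `<=` D, chain C & height D #<= C].
Proof.
move=> /finite_card_sup[|C [CD Cch] le]; last by exists C.
by exists set0; split => // a b [].
Qed.

Lemma finite_chain_least (C : set P) : finite_set C -> C !=set0 -> chain C ->
  exists2 c, C c & forall a, C a -> (c <= a)%O.
Proof.
move=> [n]; elim: n C => [|n IH] C.
  by rewrite II0 card_eq0 => /eqP -> [? []].
move=> /eq_cardSP[c Cc Cn] _ Cch.
have [nC|] := pselect (C `\ c !=set0); last first.
  move=> nC; exists c => // a Ca; have [->//|ac] := pselect (a = c).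
  by case: nC; exists a.
have [|m [Cm mc] mP] := IH _ Cn nC; first by move=> a b [Ca _] [Cb _]; exact: Cch.
have [cm|mc'] := Cch c m Cc Cm.
  exists c => // a Ca; have [->//|ac] := pselect (a = c).
  by apply: le_trans cm _; apply: mP.
by exists m => // a Ca; have [->//|ac] := pselect (a = c); apply: mP.
Qed.

End Heights.

(** * Chains in a product of two posets *)

Section ChainInProduct.
Context {d1 d2 : Order.disp_t} {P : porderType d1} {Q : porderType d2}.
Variable C : set (P *p Q)%type.
Hypothesis Cch : chain C.

Let above (c : (P *p Q)%type) := exists2 c', C c' & c'.1 = c.1 /\ (c' < c)%O.
Let code (c : (P *p Q)%type) : P + Q :=
  if pselect (above c) then inr c.2 else inl c.1.

Let code_fun : set_fun C (card_add (fst @` C) (snd @` C)) code.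
Proof.
move=> c Cc; rewrite /code; case: pselect => ?.
  by right; exists c.2 => //; exists c.
by left; exists c.1 => //; exists c.
Qed.

(** If [a < b] have the same second coordinate and [c < b] has the first
    coordinate of [b], then [c] is not above [a] since its second coordinate is
    smaller, and [c <= a] squeezes the first coordinate of [a] to that of [b]. *)
Let code_inj : set_inj C code.
Proof.
suff H a b : C a -> C b -> (a <= b)%O -> code a = code b -> a = b.
  move=> a b /set_mem Ca /set_mem Cb e; have [ab|ba] := Cch Ca Cb.
    exact: H.
  by apply/esym; apply: H.
move=> Ca Cb ab; rewrite /code; case: pselect => ha; case: pselect => hb //= [e].
  move: hb => [c Cc [c1 ltcb]].
  move: (ab); rewrite Order.ProdOrder.leEprod => /andP[ab1 _].
  have [ac|ca] := Cch Ca Cc.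
    (* The second coordinate of [c] lies between those of [a] and [b]. *)
    move: ac (ltW ltcb); rewrite !Order.ProdOrder.leEprod => /andP[_ ac] /andP[_ cb].
    have e2 : c.2 = b.2 by apply: le_anti; rewrite cb -e ac.
    by move: ltcb; rewrite (_ : c = b) ?ltxx // (surjective_pairing c) c1 e2
      -surjective_pairing.
  move: ca; rewrite Order.ProdOrder.leEprod => /andP[ca1 _].
  have e1 : a.1 = b.1 by apply: le_anti; rewrite ab1 -c1 ca1.
  by rewrite (surjective_pairing a) e1 e -surjective_pairing.
apply: contrapT => nab; apply: hb; exists a => //; split=> //.
by rewrite lt_neqAle ab andbT; apply/eqP.
Qed.

Lemma card_chain_prod : C #<= card_add (fst @` C) (snd @` C).
Proof. exact: set_inj_card_le code_fun code_inj. Qed.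

(** An element coded by the second coordinate of the least element [c0] would
    lie above some [c'] with the same first coordinate, and [c0 <= c'] makes the
    second coordinates equal as well. *)
Lemma card_chain_prod_least c0 : C c0 -> (forall c, C c -> (c0 <= c)%O) ->
  C #<= card_sub1 (card_add (fst @` C) (snd @` C)).
Proof.
move=> C0 c0P; apply: (@card_le_sub1P _ _ _ _ (inr c0.2)).
  by right; exists c0.2 => //; exists c0.
apply: (@set_inj_card_le _ _ _ _ code) code_inj => c Cc; split; first exact: code_fun.
rewrite /code /=; case: pselect => // -[c' Cc' [c1 lt]] [e].
move: (c0P _ Cc') (ltW lt); rewrite !Order.ProdOrder.leEprod => /andP[_ l1] /andP[_ l2].
have e2 : c'.2 = c.2 by apply: le_anti; rewrite l2 e l1.
by move: lt; rewrite (_ : c' = c) ?ltxx // (surjective_pairing c') c1 e2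
   -surjective_pairing.
Qed.

Lemma card_chain_prod_sub1 :
  C #<= card_sub1 (card_add (fst @` C) (snd @` C)).
Proof.
have [Cfin|Cinf] := pselect (finite_set C); last first.
  apply: card_le_trans (infinite_card_sub1 Cinf) _.
  by apply: card_le_sub1; exact: card_chain_prod.
have [C0|nC] := pselect (C !=set0).
  by have [c Cc cP] := finite_chain_least Cfin C0 Cch; exact: card_chain_prod_least cP.
have -> : C = set0 by apply: contrapT => /eqP/set0P.
exact: card_ge0.
Qed.

End ChainInProduct.

Lemma image_chain {d1 d2 : Order.disp_t} {P : porderType d1} {Q : porderType d2}
    (f : P -> Q) (C : set P) :
  {in C &, {homo f : a b / (a <= b)%O}} -> chain C -> chain (f @` C).
Proof.
move=> fh Cch _ _ [a Ca <-] [b Cb <-].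
by have [|] := Cch a b Ca Cb; [left|right]; apply: fh => //; exact: mem_set.
Qed.

(** * Modular elements *)

Section Modular.
Context {d : Order.disp_t} {L : latticeType d} (x : L).

Definition meet_join (a : L) : (L *p L)%type := (x `&` a, x `|` a)%O.

(** Exchanging the equal meets, then the equal joins, in the modular identity
    gives [a = a `|` (x `&` b) = (a `|` x) `&` b = b]. *)
Lemma modular_cancel (a b : L) : modular_elt x -> (a <= b)%O ->
  (x `&` a = x `&` b)%O -> (x `|` a = x `|` b)%O -> a = b.
Proof.
move=> xm ab em ej; have := xm a b ab.
by rewrite -em (join_l (leIr _ _)) (joinC a) ej (meet_r (leUr _ _)).
Qed.

Lemma meet_join_mono (C : set L) : modular_elt x -> chain C ->
  {in C &, {mono meet_join : a b / (a <= b)%O}}.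
Proof.
move=> xm Cch a b /set_mem Ca /set_mem Cb.
have homo u v : (u <= v)%O -> (meet_join u <= meet_join v)%O.
  by move=> uv; rewrite Order.ProdOrder.leEprod /= leI2 // leU2.
apply/idP/idP => [le|]; last exact: homo.
have [//|ba] := Cch a b Ca Cb.
have /le_anti [em ej] : (meet_join b <= meet_join a <= meet_join b)%O.
  by rewrite le homo.
by rewrite (modular_cancel xm ba).
Qed.

Lemma height_modular_le : modular_elt x ->
  height [set: L] #<=
    card_sub1 (card_add (height (down_set x)) (height (up_set x))).
Proof.
move=> xm; apply: height_le => C _ Cch.
have fm := meet_join_mono xm Cch.
have Dch : chain (meet_join @` C).
  by apply: image_chain Cch => a b Ca Cb; rewrite fm.
have eD : C #<= meet_join @` C.
  apply: (@set_inj_card_le _ _ _ _ meet_join) => [a Ca|a b Ca Cb e].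
    by exists a.
  by apply: le_anti; rewrite -!fm // e lexx.
apply: card_le_trans eD _; apply: card_le_trans (card_chain_prod_sub1 Dch) _.
apply: card_le_sub1; apply: card_le_add; apply: chain_le_height.
- by move=> _ [_ [a _ <-] <-]; rewrite /down_set /= leIl.
- by apply: image_chain Dch => u v _ _; rewrite Order.ProdOrder.leEprod => /andP[].
- by move=> _ [_ [a _ <-] <-]; rewrite /up_set /= leUl.
- by apply: image_chain Dch => u v _ _; rewrite Order.ProdOrder.leEprod => /andP[].
Qed.

End Modular.

(** * Gluing chains at a point *)

(** The two copies of the common point [x] in [A + B] account for the
    subtracted 1.  When [x] is missing from [B], it is first added to [B]. *)
Lemma card_sub1_add_le_setU (T : Type) (x : T) (A B : set T) :
  A `&` B `<=` [set x] -> card_sub1 (card_add A B) #<= x |` (A `|` B).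
Proof.
move=> ABx.
have le : card_add A B #<= card_add A (x |` B).
  by apply: card_le_add => //; apply: subset_card_le => b; right.
apply: card_le_trans (card_le_sub1 le) _.
apply: (@card_le_trans _ _ _ (card_add A (x |` B) `\ inr x)).
  rewrite /card_sub1; case: pselect => [S0|[]]; last first.
    by exists (inr x); right; exists x => //; left.
  apply: card_le_setD1 => //; first by case: (cid S0).
  by right; exists x => //; left.
pose h (u : T + T) := match u with inl a => a | inr b => b end.
apply: (@set_inj_card_le _ _ _ _ h) => [_ [[[a Aa <-]|[b [->|Bb] <-]] ne]|].
- by right; left.
- by left.
- by right; right.
have apart a b : A a -> (x |` B) b -> ~ [set inr x] (@inr T T b) -> a <> b.
  move=> Aa [->|Bb] ne e; first exact: ne.
  by apply: ne; rewrite /= (ABx b) //; split=> //; rewrite -e.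
move=> u v /set_mem[[[a Aa <-]|[b xBb <-]] ne].
  by move=> /set_mem[[[a' _ <-]|[b' xBb' <-]] ne'] /= [e]; [rewrite e|case: (apart a b')].
by move=> /set_mem[[[a' Aa' <-]|[b' _ <-]] ne'] /= [e]; [case: (apart a' b)|rewrite e].
Qed.

Section Glue.
Context {d : Order.disp_t} {P : porderType d} (x : P).

Lemma glue_chain (A B : set P) : A `<=` down_set x -> B `<=` up_set x ->
  chain A -> chain B -> chain (x |` (A `|` B)).
Proof.
move=> Ax Bx Ach Bch a b [->|[Aa|Ba]] [->|[Ab|Bb]].
- by left.
- by right; exact: Ax.
- by left; exact: Bx.
- by left; exact: Ax.
- exact: Ach.
- by left; apply: (le_trans (Ax _ Aa)); exact: Bx.
- by right; exact: Bx.
- by right; apply: (le_trans (Ax _ Ab)); exact: Bx.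
- exact: Bch.
Qed.

Lemma height_glue_ge :
  card_sub1 (card_add (height (down_set x)) (height (up_set x)))
    #<= height [set: P].
Proof.
have le (D : set P) : height D #<= height [set: P].
  by apply: height_le => C _ Cch; exact: chain_le_height.
have [Kfin|Kinf] := pselect (finite_set (height [set: P])); last first.
  apply: card_le_trans (card_sub1_le _) _.
  by apply: card_le_trans (infinite_card_add Kinf); exact: card_le_add.
have [A [Ax Ach hA]] := finite_height (card_le_finite (le (down_set x)) Kfin).
have [B [Bx Bch hB]] := finite_height (card_le_finite (le (up_set x)) Kfin).
apply: card_le_trans (card_le_sub1 (card_le_add hA hB)) _.
have ABx : A `&` B `<=` [set x].
  by move=> a [/Ax ax /Bx xa]; apply: le_anti; rewrite ax.
apply: card_le_trans (card_sub1_add_le_setU ABx) _.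
by apply: chain_le_height => //; exact: glue_chain.
Qed.

End Glue.

Theorem proposition3p2 (d : Order.disp_t) (L : latticeType d) (x : L)
  (hx : modular_elt x) :
  (forall C : set L, chain C ->
     exists2 f : L -> (L *p L)%type,
       f @` C `<=` down_set x `*` up_set x &
       {in C &, {mono f : a b / (a <= b)%O}}) /\
  height [set: L] #= card_sub1 (card_add (height (down_set x)) (height (up_set x))).
Proof.
split=> [C Cch|].
  exists (meet_join x); last exact: meet_join_mono.
  by move=> _ [a _ <-]; split; rewrite /down_set /up_set /= ?leIl ?leUl.
by rewrite card_eq_le height_modular_le // height_glue_ge.
Qed.
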